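(* Let $k\ge2$ be an integer. The maximal rank of real $k$-tensors of size $2\times\cdots\times2$ is less than or equal to $2^{k-2}+1$.
   Context: A real $k$-tensor of size $2\times\cdots\times2$ is an array $(t_{i_1,\ldots,i_k})$ with $i_1,\dots,i_k\in\{1,2\}$ and entries in $\mathbb{R}$. A rank one tensor is an outer product of $k$ nonzero vectors of $\mathbb{R}^2$; the rank of a tensor is the smallest $s\ge0$ such that it is a sum of $s$ rank one tensors over $\mathbb{R}$. The maximal rank is the maximum of the ranks of all such tensors. *)

(* Defs.v *)
From mathcomp Require Import all_boot all_order all_algebra.
From mathcomp Require Import reals.

Set Implicit Arguments.
Unset Strict Implicit.
Unset Printing Implicit Defensive.

Import Order.TTheory GRing.Theory Num.Theory.
Local Open Scope ring_scope.

(* Each index runs over 'I_2 = {0, 1}, standing for {1, 2}. *)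
Notation tensor2 R k := {ffun {ffun 'I_k -> 'I_2} -> R}.

Definition outer_product (R : realType) (k : nat) (v : 'I_k -> 'rV[R]_2) :
    tensor2 R k :=
  [ffun i : {ffun 'I_k -> 'I_2} => \prod_(j < k) v j 0 (i j)].

Definition rank_one (R : realType) (k : nat) (T : tensor2 R k) : Prop :=
  exists v : 'I_k -> 'rV[R]_2, (forall j, v j != 0) /\ T = outer_product v.

Definition sum_of_rank_one (R : realType) (k : nat) (T : tensor2 R k)
    (s : nat) : Prop :=
  exists U : 'I_s -> tensor2 R k,
    (forall l, rank_one (U l)) /\ T = \sum_(l < s) U l.

Definition is_tensor_rank (R : realType) (k : nat) (T : tensor2 R k)
    (r : nat) : Prop :=
  sum_of_rank_one T r /\ (forall s, sum_of_rank_one T s -> (r <= s)%N).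

(* The second clause requires every tensor to have a rank, so that no tensor
   is left out of the maximum. *)
Definition is_maximal_rank (R : realType) (k m : nat) : Prop :=
  (exists T : tensor2 R k, is_tensor_rank T m) /\
  (forall T : tensor2 R k, exists2 r, is_tensor_rank T r & (r <= m)%N).

(* Main.v *)
(* Write T = sum_e A_e (x) e with 2 x 2 x 2 slices A_e, where e runs over the
   2^(k-3) basis tensors of the last k - 3 factors.  For a generic rank one
   2 x 2 x 2 tensor W and every c large enough, A_e - c W has positive
   hyperdeterminant, hence is a sum of two rank one tensors.  The same W and c
   serve all e, and the correction sum_e c W (x) e = c W (x) (1,1) (x) ... (x) (1,1)
   has rank one, which gives 2 * 2^(k-3) + 1 terms. *)

Require Import Defs.
From mathcomp Require Import all_boot all_order all_algebra.
From mathcomp Require Import boolp reals.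
From mathcomp Require Import ring lra.

Set Implicit Arguments.
Unset Strict Implicit.
Unset Printing Implicit Defensive.

Import Order.TTheory GRing.Theory Num.Theory.
Local Open Scope ring_scope.

(** * Vectors and singular matrices in dimension two *)

Lemma ord2_ind (P : 'I_2 -> Prop) : P 0 -> P 1 -> forall a, P a.
Proof.
move=> P0 P1 [[|[|m]] lt_m2] //.
- by have -> : Ordinal lt_m2 = 0 by exact: val_inj.
- by have -> : Ordinal lt_m2 = 1 by exact: val_inj.
Qed.

Definition row2 (F : nmodType) (x y : F) : 'rV[F]_2 :=
  \row_a (if a == 0 then x else y).

Lemma row2_0 (F : nmodType) (x y : F) : row2 x y 0 0 = x.
Proof. by rewrite mxE. Qed.

Lemma row2_1 (F : nmodType) (x y : F) : row2 x y 0 1 = y.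
Proof. by rewrite mxE. Qed.

Definition row2E := (row2_0, row2_1).

(** The second row is a multiple of the first, unless the first is zero and only the second
    remains. *)
Lemma det0_outer (F : fieldType) (M : 'I_2 -> 'I_2 -> F) :
  M 0 0 * M 1 1 = M 0 1 * M 1 0 ->
  exists u v : 'rV[F]_2, forall a b, M a b = u 0 a * v 0 b.
Proof.
move=> detM; have [M00|M00] := eqVneq (M 0 0) 0.
  have [M01|M01] := eqVneq (M 0 1) 0.
    exists (row2 0 1), (row2 (M 1 0) (M 1 1)).
    by do 2!elim/ord2_ind; rewrite !row2E ?mul0r ?mul1r.
  have M10 : M 1 0 = 0.
    by apply/eqP; move/eqP: detM; rewrite M00 mul0r eq_sym mulf_eq0 (negbTE M01).
  exists (row2 1 (M 1 1 / M 0 1)), (row2 0 (M 0 1)).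
  by do 2!elim/ord2_ind; rewrite !row2E ?mulr0 ?mul1r ?divfK.
exists (row2 1 (M 1 0 / M 0 0)), (row2 (M 0 0) (M 0 1)).
do 2!elim/ord2_ind; rewrite !row2E ?mul1r ?divfK //.
by rewrite mulrAC -(mulrC (M 0 1)) -detM mulrAC divff ?mul1r.
Qed.

(** * Hyperdeterminant and sums of two outer products *)

(* The discriminant of the binary quadratic form det (x A0 + y A1), where
   A0, A1 are the slices of A along its third index. *)
Definition hyperdet (F : pzRingType) (A : 'I_2 -> 'I_2 -> 'I_2 -> F) : F :=
  (A 0 0 0 * A 1 1 1 + A 1 1 0 * A 0 0 1
     - A 0 1 0 * A 1 0 1 - A 1 0 0 * A 0 1 1) ^+ 2
  - 4 * (A 0 0 0 * A 1 1 0 - A 0 1 0 * A 1 0 0)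
      * (A 0 0 1 * A 1 1 1 - A 0 1 1 * A 1 0 1).

Lemma binary_form_roots (R : rcfType) (p q r : R) : 0 < q ^+ 2 - 4 * p * r ->
  exists x1 y1 x2 y2 : R,
    [/\ p * x1 ^+ 2 + q * x1 * y1 + r * y1 ^+ 2 = 0,
        p * x2 ^+ 2 + q * x2 * y2 + r * y2 ^+ 2 = 0
      & x1 * y2 - x2 * y1 != 0].
Proof.
move=> D_gt0; have [s sD s0] : exists2 s, s ^+ 2 = q ^+ 2 - 4 * p * r
    & s * (s + q) != 0.
  have sD := sqr_sqrtr (ltW D_gt0).
  have := D_gt0; rewrite -sqrtr_gt0; move: (Num.sqrt _) sD => s sD s_gt0.
  (* Giving the root the sign of [q] prevents cancellation in [s + q]. *)
  have [q_ge0|q_lt0] := lerP 0 q; [exists s|exists (- s)] => //.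
  - by apply: lt0r_neq0; nra.
  - by rewrite sqrrN.
  - by apply: lt0r_neq0; nra.
(* The quadratic formula gives one projective root; the other is written in rationalised form, so
   that [p = 0] or [r = 0] needs no separate case. *)
exists (- q - s), (2 * p), (2 * r), (- q - s); split.
- have -> : p * (- q - s) ^+ 2 + q * (- q - s) * (2 * p) + r * (2 * p) ^+ 2
            = p * (s ^+ 2 - (q ^+ 2 - 4 * p * r)) by ring.
  by rewrite sD subrr mulr0.
- have -> : p * (2 * r) ^+ 2 + q * (2 * r) * (- q - s) + r * (- q - s) ^+ 2
            = r * (s ^+ 2 - (q ^+ 2 - 4 * p * r)) by ring.
  by rewrite sD subrr mulr0.
have -> : (- q - s) * (- q - s) - 2 * r * (2 * p)
          = 2 * (s * (s + q)) - (s ^+ 2 - (q ^+ 2 - 4 * p * r)) by ring.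
by rewrite sD subrr subr0 mulf_neq0 // pnatr_eq0.
Qed.

(** The pencil spanned by the two slices has two independent singular members, both outer products;
    the slices are combinations of these. *)
Lemma hyperdet_gt0_sum2 (R : rcfType) (A : 'I_2 -> 'I_2 -> 'I_2 -> R) :
  0 < hyperdet A ->
  exists u1 v1 w1 u2 v2 w2 : 'rV[R]_2, forall a b c,
    A a b c = u1 0 a * v1 0 b * w1 0 c + u2 0 a * v2 0 b * w2 0 c.
Proof.
move/binary_form_roots => [x1 [y1 [x2 [y2 [root1 root2 indep]]]]].
have [|u1 [v1 E1]] := @det0_outer R (fun a b => x1 * A a b 0 + y1 * A a b 1).
  by apply/eqP; rewrite -subr_eq0; apply/eqP; rewrite -[RHS]root1; ring.
have [|u2 [v2 E2]] := @det0_outer R (fun a b => x2 * A a b 0 + y2 * A a b 1).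
  by apply/eqP; rewrite -subr_eq0; apply/eqP; rewrite -[RHS]root2; ring.
set d := x1 * y2 - x2 * y1 in indep.
(* Cramer's rule for the slices in terms of the two singular members. *)
exists u1, v1, (row2 (y2 / d) (- x2 / d)), u2, v2, (row2 (- y1 / d) (x1 / d)).
move=> a b; elim/ord2_ind; rewrite -E1 -E2 !row2E.
- by rewrite /d; field.
- by rewrite /d; field.
Qed.

(** * Subtracting a generic outer product *)

Lemma quadratic_gt0 (R : realFieldType) (a p q c : R) : 0 < a ->
  (`|p| + `|q|) / a + 1 <= c -> 0 < a * c ^+ 2 + p * c + q.
Proof.
move=> a_gt0 le_c.
have c_ge1 : 1 <= c.
  by apply: le_trans le_c; rewrite lerDr divr_ge0 ?addr_ge0 // ltW.
have le_ac : `|p| + `|q| + a <= a * c.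
  have := ler_wpM2l (ltW a_gt0) le_c.
  by rewrite mulrDr mulr1 mulrCA divff ?mulr1 ?gt_eqF.
have := ler_norm (- p); have := ler_norm (- q); rewrite !normrN.
have := normr_ge0 p; have := normr_ge0 q.
move: `|p| `|q| le_ac => p' q' le_ac q'_ge0 p'_ge0 Hq Hp.
(* Multiplying [le_ac] by [c >= 1] bounds [a * c ^+ 2] below by [p' * c + q' + a]. *)
nra.
Qed.

(** The [size p] distinct naturals below [size p] are too many to be all roots. *)
Lemma exists_nonroot (R : numDomainType) (p : {poly R}) : p != 0 ->
  exists t, ~~ root p t.
Proof.
move=> p_neq0; pose s := [seq (i%:R : R) | i <- iota 0 (size p)].
have [/(max_poly_roots p_neq0)|/allPn[t _ pt]] := boolP (all (root p) s);
  last by exists t.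
rewrite map_inj_uniq ?iota_uniq; last by move=> i j /eqP; rewrite eqr_nat => /eqP.
by rewrite size_map size_iota ltnn => /(_ isT).
Qed.

(** Evaluation of [A] on (1, x), (1, y), (1, z), which annihilate (-x, 1), (-y, 1), (-z, 1)
    respectively. *)
Definition contract (F : pzRingType) (A : 'I_2 -> 'I_2 -> 'I_2 -> F)
    (x y z : F) : F :=
  A 0 0 0 + A 1 0 0 * x + A 0 1 0 * y + A 1 1 0 * x * y
  + (A 0 0 1 + A 1 0 1 * x + A 0 1 1 * y + A 1 1 1 * x * y) * z.

(* The exponents in (t, t^2, t^4) give the eight entries of A distinct powers
   of t, so t only has to avoid the roots of finitely many nonzero polynomials. *)
Lemma generic_point (R : numDomainType) (I : finType)
    (A : I -> 'I_2 -> 'I_2 -> 'I_2 -> R) :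
  exists t, forall i,
    (forall a b c, A i a b c = 0) \/ contract (A i) t (t ^+ 2) (t ^+ 4) != 0.
Proof.
(* The entry with indices a, b, c sits at position a + 2b + 4c. *)
pose s i := [:: A i 0 0 0; A i 1 0 0; A i 0 1 0; A i 1 1 0;
                A i 0 0 1; A i 1 0 1; A i 0 1 1; A i 1 1 1].
have [|t] := @exists_nonroot R (\prod_(i | Poly (s i) != 0) Poly (s i)).
  by apply/prodf_neq0.
rewrite rootE horner_prod => /prodf_neq0 t_nonroot; exists t => i.
have [Pi0|Pi_neq0] := eqVneq (Poly (s i)) 0; [left|right].
  have s0 m : (s i)`_m = 0 by rewrite -coef_Poly Pi0 coef0.
  do 3!elim/ord2_ind; [exact: (s0 0)|exact: (s0 4)|exact: (s0 2)|exact: (s0 6)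
    |exact: (s0 1)|exact: (s0 5)|exact: (s0 3)|exact: (s0 7)].
have := t_nonroot _ Pi_neq0; rewrite horner_Poly /=.
by congr (_ != 0); rewrite /contract; ring.
Qed.

(* In a basis of each factor starting with the vector (-x, 1), (-y, 1), (-z, 1),
   the subtracted tensor is c e0 (x) e0 (x) e0, so c only affects the 000 entry,
   in which the hyperdeterminant is quadratic with leading coefficient the
   square of the 111 entry, here contract A x y z. *)
Lemma hyperdet_sub_outer (F : comPzRingType) (A : 'I_2 -> 'I_2 -> 'I_2 -> F)
    (x y z c : F) :
  let B c a b d := A a b d -
    c * row2 (- x) 1 0 a * row2 (- y) 1 0 b * row2 (- z) 1 0 d in
  let h := contract A x y z ^+ 2 in
  hyperdet (B c) = h * c ^+ 2 + (hyperdet (B 1) - hyperdet A - h) * c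
                   + hyperdet A.
Proof. by rewrite /hyperdet /contract /= !row2E; ring. Qed.

Lemma sub_outer_sum2 (R : rcfType) (A : 'I_2 -> 'I_2 -> 'I_2 -> R) (x y z : R) :
  (forall a b d, A a b d = 0) \/ contract A x y z != 0 ->
  exists c0, 0 <= c0 /\ forall c, c0 <= c ->
  exists u1 v1 w1 u2 v2 w2 : 'rV[R]_2, forall a b d,
    A a b d - c * row2 (- x) 1 0 a * row2 (- y) 1 0 b * row2 (- z) 1 0 d
    = u1 0 a * v1 0 b * w1 0 d + u2 0 a * v2 0 b * w2 0 d.
Proof.
(* For a zero slice the difference is already a single outer product, with [- c] absorbed in its
   first vector. *)
case=> [A0|cA].
  exists 0; split=> // c _.
  exists (- c *: row2 (- x) 1), (row2 (- y) 1), (row2 (- z) 1), 0, 0, 0.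
  by move=> a b d; rewrite A0 !mxE; ring.
set h := contract A x y z ^+ 2.
have h_gt0 : 0 < h by rewrite exprn_even_gt0.
pose B c a b d := A a b d -
  c * row2 (- x) 1 0 a * row2 (- y) 1 0 b * row2 (- z) 1 0 d.
exists ((`|hyperdet (B 1) - hyperdet A - h| + `|hyperdet A|) / h + 1); split.
  by rewrite addr_ge0 // divr_ge0 ?addr_ge0 // ltW.
move=> c le_c; apply: (@hyperdet_gt0_sum2 _ (B c)).
by rewrite hyperdet_sub_outer; exact: quadratic_gt0 h_gt0 le_c.
Qed.

(** * Upper bounds on rank and the maximal rank *)

Section RankAtMost.
Variable R : realType.
Implicit Types k n s : nat.

(** Zero vectors and shorter lists are allowed, so that bounds add under concatenation. *)
Definition rank_le k (T : tensor2 R k) s :=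
  exists2 l : seq ('I_k -> 'rV[R]_2), (size l <= s)%N
    & T = \sum_(v <- l) outer_product v.

Lemma rank_leD k (T U : tensor2 R k) s n :
  rank_le T s -> rank_le U n -> rank_le (T + U) (s + n).
Proof.
move=> [l le_l ->] [m le_m ->]; exists (l ++ m); last by rewrite big_cat.
by rewrite size_cat leq_add.
Qed.

Lemma rank_le_sum k (I : finType) (T : I -> tensor2 R k) s :
  (forall i, rank_le (T i) s) -> rank_le (\sum_i T i) (#|I| * s).
Proof.
move=> rkT; rewrite -sum_nat_const.
elim/big_ind2: _ => //; first by exists [::]; rewrite ?big_nil.
by move=> T1 s1 T2 s2; exact: rank_leD.
Qed.

Lemma rank_le_outer k (v : 'I_k -> 'rV[R]_2) : rank_le (outer_product v) 1.
Proof. by exists [:: v]; rewrite ?big_seq1. Qed.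

Lemma rank_le_sum_of_rank_one k (T : tensor2 R k) n :
  rank_le T n -> exists2 s, (s <= n)%N & sum_of_rank_one T s.
Proof.
case=> l le_l ->; pose p (v : 'I_k -> 'rV[R]_2) := [forall j, v j != 0].
exists (size [seq v <- l | p v]).
  by rewrite size_filter (leq_trans (count_size _ _)).
exists (fun i => outer_product (tnth (in_tuple [seq v <- l | p v]) i)); split.
  move=> i; exists (tnth (in_tuple [seq v <- l | p v]) i); split=> //.
  by apply/forallP; exact: (elimT (all_tnthP (t := in_tuple _)) (filter_all p l)).
rewrite -(big_tnth _ _ _ xpredT (fun v => outer_product v)) big_filter.
rewrite [LHS](bigID p) /= [X in _ + X]big1 ?addr0 // => v.
rewrite negb_forall => /existsP[j]; rewrite negbK => /eqP vj0.
by apply/ffunP=> i; rewrite !ffunE (bigD1 j) //= vj0 mxE mul0r.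
Qed.

(** The set of attained ranks is bounded, and nonempty because the zero tensor has a rank, so it has
    a maximum. *)
Lemma rank_le_maximal_rank k n : (forall T : tensor2 R k, rank_le T n) ->
  exists2 m, is_maximal_rank R k m & (m <= n)%N.
Proof.
move=> rk_n.
have rankP (T : tensor2 R k) : exists2 r, is_tensor_rank T r & (r <= n)%N.
  have [s le_sn Ts] := rank_le_sum_of_rank_one (rk_n T).
  have [r /asboolP Tr r_min] := ex_minnP
    (ex_intro (fun s => `[< sum_of_rank_one T s >]) s (asboolT Ts)).
  exists r; last by apply: leq_trans le_sn; apply/r_min/asboolP.
  by split=> // q Tq; apply/r_min/asboolP.
have rank_uniq (T : tensor2 R k) r q :
    is_tensor_rank T r -> is_tensor_rank T q -> r = q.
  move=> [Tr r_min] [Tq q_min]; apply/eqP.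
  by rewrite eqn_leq r_min // q_min.
pose attained m := `[< exists T : tensor2 R k, is_tensor_rank T m >].
have ex_att : exists m, attained m.
  by have [r r0 _] := rankP 0; exists r; apply/asboolP; exists 0.
have att_le m : attained m -> (m <= n)%N.
  by move=> /asboolP[T Tm]; have [r /(rank_uniq _ _ _ Tm) ->] := rankP T.
have [m att_m m_max] := ex_maxnP ex_att att_le.
exists m; last exact: att_le.
split=> [|T]; first exact/asboolP.
by have [r Tr _] := rankP T; exists r => //; apply/m_max/asboolP; exists T.
Qed.

(** * Slicing along the last factors *)

Definition vec3 n (u v w : 'rV[R]_2) (f : 'I_n -> 'rV[R]_2) (j : 'I_(3 + n)) :=
  match split j with
  | inl a => if a == 0 then u else if a == 1 then v else w
  | inr b => f b
  end.

Lemma outer_product_vec3 n u v w (f : 'I_n -> 'rV[R]_2)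
    (i : {ffun 'I_(3 + n) -> 'I_2}) :
  outer_product (vec3 u v w f) i
  = u 0 (i (lshift n 0)) * v 0 (i (lshift n 1)) * w 0 (i (lshift n 2%:R))
    * \prod_(j < n) f j 0 (i (rshift 3 j)).
Proof.
rewrite ffunE big_split_ord /=; congr (_ * _); last first.
  by apply: eq_bigr => j _; rewrite /vec3 (unsplitK (inr j)).
rewrite !big_ord_recl big_ord0 mulr1 mulrA /vec3 !(unsplitK (inl _)) /=.
have -> : lift ord0 ord0 = 1 :> 'I_3 by exact: val_inj.
by have -> : lift ord0 (lift ord0 ord0) = 2%:R :> 'I_3 by exact: val_inj.
Qed.

Lemma rank_le_slices n (T : tensor2 R (3 + n)) : rank_le T (2 ^ n * 2 + 1).
Proof.
pose ix (e : {ffun 'I_n -> 'I_2}) (a b c : 'I_2) : {ffun 'I_(3 + n) -> 'I_2} :=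
  [ffun j : 'I_(3 + n) => match split j with
    | inl p => if p == 0 then a else if p == 1 then b else c
    | inr q => e q end].
pose A e a b c := T (ix e a b c).
have [t t_generic] := @generic_point R _ A.
have [c0 c0P] := fin_all_exists (fun e => sub_outer_sum2 (t_generic e)).
(* A sum of nonnegative thresholds dominates each of them. *)
pose c := \sum_e c0 e.
have le_c e : c0 e <= c.
  rewrite /c (bigD1 e) //= lerDl sumr_ge0 // => e' _.
  by case: (c0P e').
pose del (e : {ffun 'I_n -> 'I_2}) j : 'rV[R]_2 := delta_mx 0 (e j).
have prod_del (e i : {ffun 'I_n -> 'I_2}) :
    \prod_(j < n) del e j 0 (i j) = (i == e)%:R.
  have [->|neq_ie] := eqVneq i e.
    by rewrite big1 // => j _; rewrite mxE !eqxx.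
  have /existsP[j neq_j] : [exists j, i j != e j].
    by apply: contraR neq_ie => /existsPn eq_ie; apply/eqP/ffunP=> j;
       apply/eqP; have := eq_ie j; rewrite negbK.
  by rewrite (bigD1 j) //= mxE (negbTE neq_j) andbF mul0r.
have /fin_all_exists[u1 /fin_all_exists[v1 /fin_all_exists[w1
     /fin_all_exists[u2 /fin_all_exists[v2 /fin_all_exists[w2 sum2]]]]]] :=
  fun e => (c0P e).2 c (le_c e).
(* The all-ones vectors add the same correction to every slice. *)
pose W := outer_product (vec3 (c *: row2 (- t) 1) (row2 (- t ^+ 2) 1)
            (row2 (- t ^+ 4) 1) (fun _ : 'I_n => const_mx 1)).
have -> : T = \sum_e (outer_product (vec3 (u1 e) (v1 e) (w1 e) (del e))
                    + outer_product (vec3 (u2 e) (v2 e) (w2 e) (del e))) + W.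
  apply/ffunP=> i; rewrite ffunE sum_ffunE.
  pose r := [ffun j => i (rshift 3 j)].
  have rE (f : 'I_n -> 'I_2 -> R) :
      \prod_(j < n) f j (i (rshift 3 j)) = \prod_(j < n) f j (r j).
    by apply: eq_bigr => j _; rewrite ffunE.
  (* At index [i] only the slice labelled by the tail [r] of [i] contributes. *)
  rewrite (bigD1 r) //= big1 => [|e neq_er]; last first.
    rewrite ffunE !outer_product_vec3 (rE (fun j => del e j 0)) prod_del.
    by rewrite eq_sym (negbTE neq_er) !mulr0 addr0.
  rewrite addr0 ffunE !outer_product_vec3 (rE (fun j => del r j 0)) prod_del.
  rewrite eqxx !mulr1 -sum2 big1 => [|j _]; last by rewrite mxE.
  have scE a : (c *: row2 (- t) 1) 0 a = c * row2 (- t) 1 0 a by rewrite mxE.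
  rewrite mulr1 scE subrK /A; congr (T _).
  apply/ffunP=> j; rewrite ffunE -{1}(splitK j).
  case: (split j) => [p|q] /=; last by rewrite ffunE.
  case: p => [[|[|[|m]]] ltm] //=; congr (i _); exact: val_inj.
apply: rank_leD; last exact: rank_le_outer.
have -> : (2 ^ n)%N = #|{: {ffun 'I_n -> 'I_2}}| by rewrite card_ffun !card_ord.
by apply: rank_le_sum => e; apply: (@rank_leD _ _ _ 1 1); exact: rank_le_outer.
Qed.

(** A matrix is the sum over [a] of the basis vector [a] tensored with row [a]. *)
Lemma rank_le_matrix (T : tensor2 R 2) : rank_le T 2.
Proof.
pose v a (j : 'I_2) : 'rV[R]_2 :=
  if j == 0 then delta_mx 0 a
  else \row_b T [ffun p : 'I_2 => if p == 0 then a else b].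
have -> : T = \sum_(a < 2) outer_product (v a).
  apply/ffunP=> i; rewrite sum_ffunE (bigD1 (i 0)) //= big1 => [|a neq_a].
    rewrite addr0 ffunE !big_ord_recl big_ord0 mulr1 /v /= !mxE !eqxx mul1r.
    congr (T _); apply/ffunP; elim/ord2_ind; rewrite ffunE //=.
    by congr (i _); exact: val_inj.
  rewrite ffunE !big_ord_recl /v /= !mxE.
  by rewrite eqxx /= eq_sym (negbTE neq_a) mul0r.
have := rank_le_sum (fun a => rank_le_outer (v a)).
by rewrite card_ord muln1.
Qed.

End RankAtMost.

Theorem theorem6p4 (R : realType) (k : nat) (hk : (2 <= k)%N) :
  exists2 m : nat, is_maximal_rank R k m & (m <= 2 ^ (k - 2) + 1)%N.
Proof.
(* Slicing needs three factors, so [k = 2] is treated apart. *)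
apply: rank_le_maximal_rank; case: k hk => [|[|[|n]]] // _ T.
  exact: rank_le_matrix.
by rewrite subSS subSS subn0 expnSr; exact: rank_le_slices.
Qed.
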